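(* Let $A\in\mathbb{R}^{Nn\times Nn}$ be a symmetric positive definite block tridiagonal matrix with $N$ diagonal blocks of size $n\times n$, and let $B_d,C_d,B_l,C_l,B_r,C_r$ be its diagonal, left stair and right stair splitting matrices. Let $(a,b)\in\mathcal{C}_g=\{(a,b)\in\mathbb{R}^2 \mid 2a+b=1,\ a\ge 0,\ b\ge -1\}$ and set $$G_{ab}=a(B_l^{-1}+B_r^{-1})+bB_d^{-1},\qquad H_{ab}=a(B_l^{-1}C_l+B_r^{-1}C_r)+bB_d^{-1}C_d.$$ Then: 1. $G_{ab}$ is symmetric positive definite. 2. The splitting $A=B_{ab}-C_{ab}$ with $B_{ab}=G_{ab}^{-1}$, $C_{ab}=G_{ab}^{-1}H_{ab}$ is convergent, i.e. $\rho(H_{ab})<1$. 3. For every integer $m\ge 1$, the matrix ${}_{ab}M_m^{-1}=(I+H_{ab}+H_{ab}^2+\dots+H_{ab}^{m-1})G_{ab}$ is symmetric positive definite.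
   Context: $N,n\ge 1$ are integers. $A\in\mathbb{R}^{Nn\times Nn}$ is symmetric positive definite and block tridiagonal: its diagonal blocks are $D_1,\dots,D_N\in\mathbb{R}^{n\times n}$, its $(k,k+1)$ block is $O_k\in\mathbb{R}^{n\times n}$ and its $(k+1,k)$ block is $O_k^{\mathrm T}$ for $k=1,\dots,N-1$; all other blocks are zero. Diagonal splitting $A=B_d-C_d$: $B_d=\mathrm{diag}(D_1,\dots,D_N)$ (block diagonal) and $C_d=B_d-A$. Left stair splitting $A=B_l-C_l$: $B_l$ has diagonal blocks $D_1,\dots,D_N$, agrees with $A$ on all even-indexed block rows, and its off-diagonal blocks in odd-indexed block rows are zero; $C_l=B_l-A$. Right stair splitting $A=B_r-C_r$: $B_r$ has diagonal blocks $D_1,\dots,D_N$, agrees with $A$ on all odd-indexed block rows, and its off-diagonal blocks in even-indexed block rows are zero; $C_r=B_r-A$. $B_d,B_l,B_r$ are invertible. $\rho(\cdot)$ denotes the spectral radius. A splitting $A=B-C$ is convergent if $B$ is nonsingular and $\rho(B^{-1}C)<1$. The symbol ${}_{ab}M_m^{-1}$ is notation for the displayed matrix. *)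

(* Defs.v *)
From mathcomp Require Import all_boot all_order all_algebra.
From mathcomp Require Import classical_sets reals.
From mathcomp Require Import complex.

Set Implicit Arguments.
Unset Strict Implicit.
Unset Printing Implicit Defensive.

Import Order.TTheory GRing.Theory Num.Theory.
Local Open Scope ring_scope.
Local Open Scope complex_scope.

(* The real matrices with N x N blocks of size n x n. The order N n appears as
   \sum_(k < N) n, the shape required by \mxblock and submxblock. *)
Notation blockmx R N n := 'M[R]_(\sum_(k < N) n)%N.

Definition spd (R : realType) (p : nat) (A : 'M[R]_p) : Prop :=
  A^T = A /\ forall x : 'cV[R]_p, x != 0 -> 0 < (x^T *m A *m x) 0 0.

(* The supremum is a maximum if p > 0; for p = 0 it is the junk value 0. *)
Definition spectral_radius (R : realType) (p : nat) (A : 'M[R]_p) : R :=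
  sup [set r : R | exists2 z : R[i],
    eigenvalue (map_mx (real_complex R) A) z & r = ComplexField.Normc.normc z]%classic.

Section Splittings.
Variables (R : realType) (N n : nat).
Implicit Types A B C : blockmx R N n.

Definition block_tridiagonal A : Prop :=
  forall i j : 'I_N, (i.+1 < j)%N || (j.+1 < i)%N -> submxblock A i j = 0.

Definition diagB A : blockmx R N n :=
  \mxblock_(i < N, j < N) (if i == j then submxblock A i j else 0).

(* Block rows are numbered 1, ..., N in the definition of the stair splittings,
   whereas i : 'I_N starts at 0: the even-indexed block rows are those with
   i odd. *)
Definition leftB A : blockmx R N n :=
  \mxblock_(i < N, j < N)
    (if (i == j) || odd i then submxblock A i j else 0).

Definition rightB A : blockmx R N n :=
  \mxblock_(i < N, j < N)
    (if (i == j) || ~~ odd i then submxblock A i j else 0).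

Definition diagC A := diagB A - A.
Definition leftC A := leftB A - A.
Definition rightC A := rightB A - A.

Definition Gab (a b : R) A : blockmx R N n :=
  a *: (invmx (leftB A) + invmx (rightB A)) + b *: invmx (diagB A).

Definition Hab (a b : R) A : blockmx R N n :=
  a *: (invmx (leftB A) *m leftC A + invmx (rightB A) *m rightC A)
  + b *: (invmx (diagB A) *m diagC A).

Definition Bab (a b : R) A : blockmx R N n := invmx (Gab a b A).
Definition Cab (a b : R) A : blockmx R N n := invmx (Gab a b A) *m Hab a b A.

(* The m-step preconditioner {}_{ab}M_m^{-1}. *)
Definition Minv (a b : R) (m : nat) A : blockmx R N n :=
  (\sum_(0 <= k < m) Hab a b A ^+ k) *m Gab a b A.

Definition splitting A B C : Prop := A = B - C.

Definition convergent_splitting A B C : Prop :=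
  [/\ splitting A B C, B \in unitmx & spectral_radius (invmx B *m C) < 1].

End Splittings.

(* Main.v *)
Require Import Defs.
From mathcomp Require Import all_boot all_order all_algebra.
From mathcomp Require Import reals.
From mathcomp Require Import classical_sets complex ring lra.

Set Implicit Arguments.
Unset Strict Implicit.

Import Order.TTheory GRing.Theory Num.Theory.
Local Open Scope ring_scope.

(** Write D for the block diagonal of A, K = D^-1 (A - D) and P for the
projection onto the block rows of odd 0-based index. Since A is block
tridiagonal, A - D couples only rows of opposite parity, so P commutes with D
and P K = K (1 - P); hence (P K)^2 = 0 and the stair matrices, which are
D (1 + P K) and D (1 + (1 - P) K), have the explicit inverses
(1 - P K) D^-1 and (1 - (1 - P) K) D^-1. Substituting, with 2 a + b = 1,
gives G = (1 - a K) D^-1 and H = 1 - G A = (1 - a) (- K) + a K^2, where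
0 <= a <= 1.

Say that F is a contraction for a positive definite X if X - X F and X + X F
are symmetric positive definite: F is self-adjoint for the inner product of X
and its spectrum lies in ]-1, 1[. Changing the sign of the block rows and
columns of odd index turns A = D + D K into D - D K
([parity_sign_congr]), so both are positive definite and K is a contraction
for D. Consequently - K and K^2 are contractions for D + D K = A
([contraction_shiftN], [contraction_shift_sqr]); contractions for A being
convex, so is H ([Hab_contraction]).

The three claims follow. The eigenvalues of a contraction are real, of modulus
less than 1, and finite in number ([contraction_spectral_radius]). By a
telescoping sum (1 + H + ... + H^(m-1)) G A = 1 - H^m, so the m-step matrix is
congruent, by A^-1, to A - A H^m ([Minv_congr]), which is positive definite
([spd_sub_exp]); the case m = 1 is G itself. All positivity statements are
obtained from sums and congruences, never from diagonalization. *)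

(** * Symmetric positive definite matrices *)

Section PositiveDefinite.
Variables (R : realType) (p : nat).
Implicit Types (X Y T F : 'M[R]_p) (x y : 'cV[R]_p).

Lemma spd_ge0 X x : spd X -> 0 <= (x^T *m X *m x) 0 0.
Proof.
move=> [_ Xpos]; have [->|x0] := eqVneq x 0; first by rewrite mulmx0 mxE.
exact/ltW/Xpos.
Qed.

Lemma spdD_congr X Y T : spd X -> spd Y -> spd (X + T^T *m Y *m T).
Proof.
move=> [Xsym Xpos] Yspd; split=> [|x x0].
  by rewrite raddfD /= !trmx_mul trmxK Xsym Yspd.1 mulmxA.
have -> : x^T *m (X + T^T *m Y *m T) *m x =
    x^T *m X *m x + (T *m x)^T *m Y *m (T *m x).
  by rewrite trmx_mul mulmxDr mulmxDl !mulmxA.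
by rewrite mxE ltr_wpDr ?spd_ge0 // Xpos.
Qed.

Lemma spdD X Y : spd X -> spd Y -> spd (X + Y).
Proof.
move=> Xspd Yspd; have := spdD_congr 1%:M Xspd Yspd.
by rewrite trmx1 mul1mx mulmx1.
Qed.

Lemma spdZ X c : 0 < c -> spd X -> spd (c *: X).
Proof.
move=> c0 [Xsym Xpos]; split=> [|x x0]; first by rewrite linearZ /= Xsym.
by rewrite -scalemxAr -scalemxAl mxE mulr_gt0 // Xpos.
Qed.

Lemma spd_convex X Y c : 0 <= c -> c <= 1 -> spd X -> spd Y ->
  spd ((1 - c) *: X + c *: Y).
Proof.
rewrite le_eqVlt => /predU1P[<- _ Xspd _|c0].
  by rewrite subr0 scale1r scale0r addr0.
rewrite le_eqVlt => /predU1P[-> _ Yspd|c1 Xspd Yspd].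
  by rewrite subrr scale1r scale0r add0r.
by apply: spdD; apply: spdZ => //; rewrite subr_gt0.
Qed.

(** A vector u in the kernel of X has u^T X u = 0. *)
Lemma spd_unitmx X : spd X -> X \in unitmx.
Proof.
move=> [_ Xpos]; rewrite -unitmx_tr -row_free_unit -kermx_eq0.
apply/eqP/row_matrixP => i; rewrite row0; apply/eqP/negPn/negP => u0.
have uX : row i (kermx X^T) *m X^T = 0 by rewrite -row_mul mulmx_ker row0.
have := Xpos (row i (kermx X^T))^T; rewrite trmx_eq0 => /(_ u0).
by rewrite -mulmxA -[X in X *m _^T]trmxK -trmx_mul uX trmx0 mulmx0 mxE ltxx.
Qed.

Lemma spd_congr X T : T \in unitmx -> spd X -> spd (T^T *m X *m T).
Proof.
move=> Tu [Xsym Xpos]; split=> [|x x0].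
  by rewrite !trmx_mul trmxK Xsym mulmxA.
have -> : x^T *m (T^T *m X *m T) *m x = (T *m x)^T *m X *m (T *m x).
  by rewrite trmx_mul !mulmxA.
apply: Xpos; apply: contraNneq x0 => Tx0.
by rewrite -(mulKmx Tu x) Tx0 mulmx0.
Qed.

End PositiveDefinite.

(** * Contractions for the inner product of a positive definite matrix *)

Section Contractions.
Variables (R : realType) (p : nat).
Implicit Types (X F E : 'M[R]_p) (c : R).

Lemma trmx_1D F : (1%:M + F)^T = 1%:M + F^T.
Proof. by rewrite linearD /= trmx1. Qed.

Lemma trmx_1B F : (1%:M - F)^T = 1%:M - F^T.
Proof. by rewrite linearB /= trmx1. Qed.

(** The self-adjointness X F = F^T X is implied by the symmetry of X and of
X + X F, see [contraction_adjoint]. *)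
Definition contraction X F :=
  [/\ spd X, spd (X - X *m F) & spd (X + X *m F)].

Lemma contraction_adjoint X F : contraction X F -> F^T *m X = X *m F.
Proof.
move=> [[Xsym _] _ [XFsym _]]; move: XFsym.
by rewrite raddfD /= trmx_mul Xsym => /addrI.
Qed.

(** X - X F and X + X F are affine in F. *)
Lemma contraction_convex X F E c : 0 <= c -> c <= 1 ->
  contraction X F -> contraction X E ->
  contraction X ((1 - c) *: F + c *: E).
Proof.
move=> c0 c1 [Xspd F1 F2] [_ E1 E2]; split=> //.
- suff -> : X - X *m ((1 - c) *: F + c *: E) =
    (1 - c) *: (X - X *m F) + c *: (X - X *m E) by exact: spd_convex.
  by rewrite mulmxDr -!scalemxAr; apply/matrixP=> i j; rewrite !mxE; ring.
- suff -> : X + X *m ((1 - c) *: F + c *: E) =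
    (1 - c) *: (X + X *m F) + c *: (X + X *m E) by exact: spd_convex.
  by rewrite mulmxDr -!scalemxAr; apply/matrixP=> i j; rewrite !mxE; ring.
Qed.

Lemma contractionN X F : contraction X F -> contraction X (- F).
Proof. by case=> Xspd Fm Fp; split; rewrite // mulmxN ?opprK. Qed.

(** 1 + F is a factor of the invertible matrix X + X F = X (1 + F). *)
Lemma unitmx_1D X F : contraction X F -> 1%:M + F \in unitmx.
Proof.
by case=> _ _ /spd_unitmx; rewrite -{1}[X]mulmx1 -mulmxDr unitmx_mul => /andP[].
Qed.

(** From 2 (1 - t^2) = (1 - t)^2 (1 + t) + (1 + t)^2 (1 - t): as F is
self-adjoint, each summand becomes a congruence of X + X F or X - X F by an
invertible matrix. *)
Lemma spd_sub_sqr X F : contraction X F -> spd (X - X *m F *m F).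
Proof.
move=> XF; have adj := contraction_adjoint XF; have [Xspd Fm Fp] := XF.
have Fmu := unitmx_1D (contractionN XF); have Fpu := unitmx_1D XF.
have -> : X - X *m F *m F =
    (1 - 2^-1) *: ((1%:M - F)^T *m (X + X *m F) *m (1%:M - F)) +
    2^-1 *: ((1%:M + F)^T *m (X - X *m F) *m (1%:M + F)).
  rewrite trmx_1B trmx_1D !(mulmxDr, mulmxDl, mulmxN, mulNmx, mul1mx, mulmx1).
  by rewrite !mulmxA !adj; apply/matrixP=> i j; rewrite !mxE; field.
by apply: spd_convex; [lra | lra | exact: spd_congr | exact: spd_congr].
Qed.

(** Induction in steps of two, from
1 - t^(m+2) = (1 - t^2) + t (1 - t^m) t, whose last term is a congruence. *)
Lemma spd_sub_exp X F m : contraction X F -> (0 < m)%N ->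
  spd (X - X *m F ^+ m).
Proof.
move=> XF; have adj := contraction_adjoint XF; have [Xspd Fm _] := XF.
have Fsqr := spd_sub_sqr XF.
have [k] := ubnP m; elim: k m => // k IHk [|[|[|m]]] // lt_mk _.
- by rewrite expr2 mulmxA.
- suff -> : X - X *m F ^+ m.+3 =
      (X - X *m F *m F) + F^T *m (X - X *m F ^+ m.+1) *m F.
    by apply: spdD_congr => //; apply: IHk => //; rewrite -ltnS ltnW.
  have -> : F ^+ m.+3 = F *m F ^+ m.+1 *m F by rewrite !mulmxE -exprS -exprSr.
  rewrite mulmxBr mulmxBl !mulmxA adj.
  by rewrite addrA subrK.
Qed.

(** With Y = X (1 + F), the matrices to consider are Y (1 + F), the congruence
of X by 1 + F, and Y (1 - F) = X (1 - F^2). *)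
Lemma contraction_shiftN X F : contraction X F ->
  contraction (X + X *m F) (- F).
Proof.
move=> XF; have adj := contraction_adjoint XF; have [Xspd Fm Fp] := XF.
split=> //.
- suff -> : X + X *m F - (X + X *m F) *m (- F) =
      (1%:M + F)^T *m X *m (1%:M + F).
    by apply: spd_congr => //; exact: unitmx_1D XF.
  by rewrite trmx_1D mulmxN opprK !mulmxDl !mulmxDr !mul1mx !mulmx1 adj.
- suff -> : X + X *m F + (X + X *m F) *m (- F) = X - X *m F *m F.
    exact: spd_sub_sqr.
  by rewrite mulmxN mulmxDl opprD addrA addrK.
Qed.

(** With Y = X (1 + F), the matrix Y (1 - F^2) = X (1 + F)^2 (1 - F) is the
congruence of X - X F by 1 + F, and Y (1 + F^2) is Y plus its congruence
by F. *)
Lemma contraction_shift_sqr X F : contraction X F ->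
  contraction (X + X *m F) (F *m F).
Proof.
move=> XF; have adj := contraction_adjoint XF; have [Xspd Fm Fp] := XF.
split=> //.
- suff -> : X + X *m F - (X + X *m F) *m (F *m F) =
      (1%:M + F)^T *m (X - X *m F) *m (1%:M + F).
    by apply: spd_congr => //; exact: unitmx_1D XF.
  rewrite trmx_1D !(mulmxDl, mulmxDr, mulmxN, mulNmx, mul1mx, mulmx1).
  by rewrite !mulmxA !adj; apply/matrixP=> i j; rewrite !mxE; ring.
- suff -> : (X + X *m F) *m (F *m F) = F^T *m (X + X *m F) *m F.
    exact: spdD_congr.
  by rewrite mulmxDr !mulmxDl !mulmxA !adj.
Qed.

End Contractions.

(** * Spectral radius *)

Section SpectralRadius.
Variables (R : realType) (p : nat).
Implicit Types (X F : 'M[R]_p).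
Local Notation normc := ComplexField.Normc.normc.

(** The strict bound passes to the supremum because the eigenvalues are the
finitely many roots of the characteristic polynomial. *)
Lemma spectral_radius_lt1 F :
  (forall z, eigenvalue (map_mx (real_complex R) F) z -> normc z < 1) ->
  spectral_radius F < 1.
Proof.
set Fc := map_mx _ F => lt1.
have [r rP] := closed_field_poly_normal (char_poly Fc).
have mem_r z : eigenvalue Fc z = (z \in r).
  rewrite eigenvalue_root_char rP (monicP (char_poly_monic Fc)) scale1r.
  exact: root_prod_XsubC.
have [c c1 cP] : exists2 c : R, c < 1 & {in r, forall z, normc z <= c}.
  have: {in r, forall z, normc z < 1} by move=> z; rewrite -mem_r; exact: lt1.
  elim: r {rP mem_r} => [_|z r IHr ltr]; first by exists 0; rewrite ?ltr01.
  have [|c c1 cP] := IHr; first by move=> w wr; apply: ltr; rewrite inE wr orbT.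
  exists (Num.max (normc z) c).
    by rewrite gt_max c1 ltr //; rewrite inE eqxx.
  move=> w; rewrite inE le_max => /predU1P[->|/cP ->]; last exact: orbT.
  by rewrite lexx.
rewrite /spectral_radius; set E := (X in sup X).
have [->|E0] := eqVneq E set0; first by rewrite sup0 ltr01.
apply: le_lt_trans c1; apply: ge_sup; first exact/set0P.
by move=> _ [z ez ->]; apply: cP; rewrite -mem_r.
Qed.

(** Let r + i s be a left eigenvector for al + i be, and r = x^T X, s = y^T X.
Then x^T X F = al r - be s and y^T X F = be r + al s. Symmetry of X F forces
be (x^T X x + y^T X y) = 0, so the eigenvalue is al; the positivity of
X - X F and X + X F at x and y says that -1 < al < 1. *)
Lemma contraction_spectral_radius X F : contraction X F ->
  spectral_radius F < 1.
Proof.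
move=> XF; have adj := contraction_adjoint XF; have [Xspd Fm Fp] := XF.
apply: spectral_radius_lt1 => -[al be] /eigenvalueP[v vF v0].
pose r : 'rV[R]_p := \row_j complex.Re (v 0 j).
pose s : 'rV[R]_p := \row_j complex.Im (v 0 j).
have rF : r *m F = al *: r - be *: s.
  apply/rowP => j; have /rowP/(_ j)/(congr1 (@complex.Re R)) := vF.
  rewrite !mxE raddf_sum /= => vFj.
  transitivity (complex.Re ((al +i* be)%C * v 0 j)); last first.
    by case: (v 0 j).
  rewrite -vFj; apply: eq_bigr => k _; rewrite !mxE; case: (v 0 k) => /= a b.
  by rewrite mulr0 subr0.
have sF : s *m F = be *: r + al *: s.
  apply/rowP => j; have /rowP/(_ j)/(congr1 (@complex.Im R)) := vF.
  rewrite !mxE raddf_sum /= => vFj.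
  transitivity (complex.Im ((al +i* be)%C * v 0 j)); last first.
    by case: (v 0 j) => a b /=; rewrite addrC.
  rewrite -vFj; apply: eq_bigr => k _; rewrite !mxE; case: (v 0 k) => /= a b.
  by rewrite mulr0 add0r.
have Xu := spd_unitmx Xspd.
pose x := (r *m invmx X)^T; pose y := (s *m invmx X)^T.
have xX : x^T *m X = r by rewrite trmxK mulmxKV.
have yX : y^T *m X = s by rewrite trmxK mulmxKV.
(* The bilinear form of Y; its sums of two diagonal values stand for the real
   Hermitian form at x + i y. *)
pose q (Y : 'M[R]_p) (u w : 'cV[R]_p) := (u^T *m Y *m w) 0 0.
have q_sym Y u w : Y^T = Y -> q Y u w = q Y w u.
  move=> Ysym; rewrite /q -[in LHS](trmxK (u^T *m Y *m w)) mxE.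
  by rewrite !trmx_mul trmxK Ysym mulmxA.
have XFsym : (X *m F)^T = X *m F by rewrite trmx_mul Xspd.1.
have qx w : q (X *m F) x w = al * q X x w - be * q X y w.
  by rewrite /q mulmxA xX yX rF mulmxBl -!scalemxAl !mxE.
have qy w : q (X *m F) y w = be * q X x w + al * q X y w.
  by rewrite /q mulmxA xX yX sF mulmxDl -!scalemxAl !mxE.
have xy0 : (x != 0) || (y != 0).
  apply: contraNT v0; rewrite negb_or !negbK => /andP[/eqP x0 /eqP y0].
  apply/eqP/rowP => j; rewrite mxE; move: xX yX.
  rewrite x0 y0 trmx0 mul0mx => /rowP/(_ j) + /rowP/(_ j).
  by rewrite !mxE; case: (v 0 j) => a b /= <- <-.
have q_gt0 Y : spd Y -> 0 < q Y x x + q Y y y.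
  move=> Yspd; case/orP: xy0 => u0.
    by rewrite ltr_wpDr ?spd_ge0 //; exact: Yspd.2.
  by rewrite ltr_wpDl ?spd_ge0 //; exact: Yspd.2.
have qD Y Z u : q (Y + Z) u u = q Y u u + q Z u u.
  by rewrite /q mulmxDr mulmxDl mxE.
have qN Y u : q (- Y) u u = - q Y u u by rewrite /q mulmxN mulNmx mxE.
have n0 := q_gt0 _ Xspd.
have be0 : be = 0.
  have := q_sym _ x y XFsym; rewrite qx qy (q_sym X y x Xspd.1) => h.
  apply/eqP; rewrite -(mulIr_eq0 _ (mulIf (lt0r_neq0 n0))); apply/eqP.
  by move: h; lra.
have := q_gt0 _ Fm; have := q_gt0 _ Fp.
rewrite !qD !qN !qx !qy (q_sym X y x Xspd.1) be0 => hp hm.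
rewrite /= expr0n addr0 sqrtr_sqr ltr_norml; apply/andP; split.
  rewrite -(ltr_pM2r n0); lra.
by rewrite -(ltr_pM2r n0); lra.
Qed.

End SpectralRadius.

(** * Inverse of a stair matrix *)

Section StairSplittings.
Variables (R : realType) (p : nat).
Implicit Types (D P K A B : 'M[R]_p).

Lemma invmx_eq B E : B *m E = 1%:M -> invmx B = E.
Proof.
by move=> BE; rewrite -[LHS]mulmx1 -BE mulKmx //; exact: (mulmx1_unit BE).1.
Qed.

(** P K is nilpotent of order two, because
P K P K = K (1 - P) P K = 0. *)
Lemma stair_mul_inv D P K : D \in unitmx -> P *m P = P ->
  P *m K = K *m (1%:M - P) ->
  (D + D *m (P *m K)) *m ((1%:M - P *m K) *m invmx D) = 1%:M.
Proof.
move=> Du PP PK.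
have PKPK : P *m K *m (P *m K) = 0.
  by rewrite {1}PK !mulmxA -(mulmxA K) mulmxBl mul1mx PP subrr mulmx0 mul0mx.
rewrite -{1}[D]mulmx1 -mulmxDr -mulmxA (mulmxA (1%:M + _)).
rewrite mulmxDl mul1mx mulmxBr mulmx1 PKPK subr0 subrK mul1mx.
exact: mulmxV.
Qed.

Lemma mulVmx_sub A B : B \in unitmx ->
  invmx B *m (B - A) = 1%:M - invmx B *m A.
Proof. by move=> Bu; rewrite mulmxBr mulVmx. Qed.

End StairSplittings.

(** * Parity structure of block tridiagonal matrices *)

Section Blocks.
Variables (R : realType) (N n : nat).
Implicit Types (A : blockmx R N n).
Local Notation blk := (@tagnat.sig1 N (fun=> n)).

Lemma mxblock_filterE A (c : 'I_N -> 'I_N -> bool) s t :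
  (\mxblock_(i < N, j < N) (if c i j then submxblock A i j else 0)) s t =
  (if c (blk s) (blk t) then A s t else 0).
Proof. by rewrite mxE; case: ifP => _; rewrite !mxE ?tagnat.sig2K. Qed.

Lemma diagBE A s t : diagB A s t = if blk s == blk t then A s t else 0.
Proof. exact: mxblock_filterE. Qed.

Lemma leftBE A s t :
  leftB A s t = if (blk s == blk t) || odd (blk s) then A s t else 0.
Proof. exact: (mxblock_filterE A (fun i j => (i == j) || odd i)). Qed.

Lemma rightBE A s t :
  rightB A s t = if (blk s == blk t) || ~~ odd (blk s) then A s t else 0.
Proof. exact: (mxblock_filterE A (fun i j => (i == j) || ~~ odd i)). Qed.

Lemma offdiagE A s t :
  (A - diagB A) s t = if blk s == blk t then 0 else A s t.
Proof.
by rewrite mxE [X in _ + X]mxE diagBE; case: ifP; rewrite ?subrr ?subr0.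
Qed.

(** Two distinct indices of the same parity differ by at least two. *)
Lemma tridiagonal_same_parity A s t : block_tridiagonal A ->
  blk s != blk t -> odd (blk s) = odd (blk t) -> A s t = 0.
Proof.
move=> Atri st par.
have {Atri} : submxblock A (blk s) (blk t) = 0.
  apply: Atri; move: st; rewrite -val_eqE neq_ltn.
  by case/orP; rewrite leq_eqVlt => /predU1P[e|->]; rewrite ?orbT //;
    move: par; rewrite -e /=; case: odd.
move=> /matrixP/(_ (tagnat.sig2 s) (tagnat.sig2 t)).
by rewrite !mxE !tagnat.sig2K.
Qed.

(** The parity is that of the 0-based block index: this is the projection onto
the even-indexed block rows when they are numbered from 1. *)
Definition odd_proj : blockmx R N n := diag_mx (\row_s (odd (blk s))%:R).
Definition parity_sign : blockmx R N n := diag_mx (\row_s (-1) ^+ blk s).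

Lemma odd_proj_mulE A s t : (odd_proj *m A) s t = (odd (blk s))%:R * A s t.
Proof. by rewrite mul_diag_mx !mxE. Qed.

Lemma mul_odd_projE A s t : (A *m odd_proj) s t = A s t * (odd (blk t))%:R.
Proof. by rewrite mul_mx_diag !mxE. Qed.

Lemma odd_proj_idem : odd_proj *m odd_proj = odd_proj.
Proof.
rewrite mulmx_diag; congr diag_mx; apply/rowP=> s.
by rewrite !mxE -natrM mulnb andbb.
Qed.

Lemma odd_proj_diagB A : odd_proj *m diagB A = diagB A *m odd_proj.
Proof.
apply/matrixP => s t; rewrite odd_proj_mulE mul_odd_projE diagBE mulrC.
by case: eqP => [->|_]; rewrite ?mul0r.
Qed.

(** The off-diagonal blocks couple rows and columns of opposite parity only. *)
Lemma odd_proj_offdiag A : block_tridiagonal A ->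
  odd_proj *m (A - diagB A) = (A - diagB A) *m (1%:M - odd_proj).
Proof.
move=> Atri; rewrite [RHS]mulmxBr mulmx1; apply/matrixP => s t.
rewrite [RHS]mxE [X in _ = _ + X]mxE odd_proj_mulE mul_odd_projE offdiagE.
have [_|st] := eqVneq; first by rewrite mulr0 mul0r subrr.
case: (eqVneq (odd (blk s)) (odd (blk t))) => [par|].
  by rewrite (tridiagonal_same_parity Atri st par) mulr0 mul0r subrr.
by do 2!case: odd; move=> //= _; rewrite ?mul1r ?mul0r ?mulr1 ?mulr0 ?subr0 ?subrr.
Qed.

Lemma leftB_odd_proj A : leftB A = diagB A + odd_proj *m (A - diagB A).
Proof.
apply/matrixP => s t; rewrite [RHS]mxE odd_proj_mulE offdiagE diagBE leftBE.
by case: eqP; case: odd; rewrite /= ?mulr0 ?mul1r ?mul0r ?addr0 ?add0r.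
Qed.

Lemma rightB_odd_proj A :
  rightB A = diagB A + (1%:M - odd_proj) *m (A - diagB A).
Proof.
rewrite mulmxBl mul1mx; apply/matrixP => s t.
rewrite [RHS]mxE [X in _ = _ + X]mxE [X in _ = _ + (_ + X)]mxE.
rewrite odd_proj_mulE offdiagE diagBE rightBE.
by case: eqP; case: odd;
  rewrite /= ?mulr0 ?mul1r ?mul0r ?subrr ?subr0 ?addr0 ?add0r.
Qed.

Lemma parity_signK : parity_sign *m parity_sign = 1%:M.
Proof.
rewrite mulmx_diag -diag_const_mx; congr diag_mx; apply/rowP=> s.
by rewrite !mxE -expr2 sqrr_sign.
Qed.

(** The off-diagonal blocks, joining opposite parities, change sign; the
diagonal ones do not. *)
Lemma parity_sign_congr A : block_tridiagonal A ->
  parity_sign^T *m A *m parity_sign = diagB A - (A - diagB A).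
Proof.
move=> Atri; apply/matrixP => s t.
rewrite [RHS]mxE [X in _ = _ + X]mxE offdiagE diagBE.
rewrite tr_diag_mx mul_mx_diag mul_diag_mx !mxE.
rewrite -signr_odd -[_ ^+ blk t]signr_odd.
have [->|st] := eqVneq (blk s); first by rewrite subr0 mulrAC -mulrA signrMK.
rewrite sub0r; case: (eqVneq (odd (blk s)) (odd (blk t))) => [par|].
  by rewrite (tridiagonal_same_parity Atri st par) mulr0 mul0r oppr0.
by do 2!case: odd; move=> //= _; rewrite ?expr0 ?expr1 ?mulN1r ?mulrN1 ?mul1r ?mulr1.
Qed.

(** Minus the iteration matrix of the block Jacobi method. *)
Definition scaled_offdiag A : blockmx R N n := invmx (diagB A) *m (A - diagB A).

(** D is the midpoint of A = D + (A - D) and D - (A - D), the latter being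
congruent to A. *)
Lemma spd_diagB A : spd A -> block_tridiagonal A ->
  spd (diagB A) /\ spd (diagB A - (A - diagB A)).
Proof.
move=> Aspd Atri.
have Bspd : spd (diagB A - (A - diagB A)).
  rewrite -parity_sign_congr //; apply: spd_congr => //.
  exact: (mulmx1_unit parity_signK).1.
split=> //.
suff -> : diagB A = (1 - 2^-1) *: A + 2^-1 *: (diagB A - (A - diagB A)).
  by apply: spd_convex => //; lra.
by move: (diagB A) => D; apply/matrixP => i j; rewrite !mxE; field.
Qed.

Lemma scaled_offdiag_contraction A : spd A -> block_tridiagonal A ->
  contraction (diagB A) (scaled_offdiag A).
Proof.
move=> Aspd Atri; have [Dspd Bspd] := spd_diagB Aspd Atri.
have DK : diagB A *m scaled_offdiag A = A - diagB A by rewrite mulKVmx ?spd_unitmx.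
by split; rewrite // DK // addrC subrK.
Qed.

(** * The combined iteration *)

Section Iteration.
Variables (A : blockmx R N n) (a b : R).
Hypotheses (Aspd : spd A) (Atri : block_tridiagonal A) (hab : 2 * a + b = 1).
Let D := diagB A.
Let P := odd_proj.
Let K := scaled_offdiag A.

Let Du : D \in unitmx.
Proof. exact/spd_unitmx/(spd_diagB Aspd Atri).1. Qed.

Let PK : P *m K = K *m (1%:M - P).
Proof.
have PV : P *m invmx D = invmx D *m P.
  apply: (can_inj (mulKmx Du)); rewrite mulmxA -odd_proj_diagB -mulmxA.
  by rewrite mulmxV // mulKVmx // mulmx1.
by rewrite /K /scaled_offdiag mulmxA PV -!mulmxA odd_proj_offdiag.
Qed.

Let DK : A = D + D *m K.
Proof. by rewrite mulKVmx // addrC subrK. Qed.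

Lemma leftB_mul_inv :
  leftB A *m ((1%:M - P *m K) *m invmx D) = 1%:M.
Proof.
have -> : leftB A = D + D *m (P *m K).
  by rewrite mulmxA -odd_proj_diagB -mulmxA mulKVmx // -leftB_odd_proj.
by apply: stair_mul_inv => //; exact: odd_proj_idem.
Qed.

Lemma rightB_mul_inv :
  rightB A *m ((1%:M - (1%:M - P) *m K) *m invmx D) = 1%:M.
Proof.
have -> : rightB A = D + D *m ((1%:M - P) *m K).
  rewrite mulmxA mulmxBr mulmx1 -odd_proj_diagB -[in X in X - _](mul1mx D).
  by rewrite -mulmxBl -mulmxA mulKVmx // -rightB_odd_proj.
apply: stair_mul_inv => //.
- by rewrite mulmxBr mulmx1 mulmxBl mul1mx odd_proj_idem subrr subr0.
- by rewrite mulmxBl mul1mx PK mulmxBr mulmx1 subKr subKr.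
Qed.

(** P K and (1 - P) K add up to K, so the projection disappears from the sum of
the two stair inverses. *)
Lemma Gab_scaled_offdiag : Gab a b A = (1%:M - a *: K) *m invmx D.
Proof.
rewrite /Gab (invmx_eq leftB_mul_inv) (invmx_eq rightB_mul_inv) -/D.
rewrite -mulmxDl -{2}[invmx D]mul1mx 2!scalemxAl -mulmxDl; congr (_ *m _).
have -> : b = 1 - 2 * a by move: hab; lra.
rewrite mulmxBl mul1mx; move: (1%:M) (P *m K) => I Z.
by apply/matrixP => i j; rewrite !mxE; ring.
Qed.

Lemma Gab_mulA : Gab a b A *m A = 1%:M - ((1 - a) *: (- K) + a *: (K *m K)).
Proof.
rewrite Gab_scaled_offdiag {1}DK -{2}[D]mulmx1 -mulmxDr -mulmxA mulKmx //.
rewrite mulmxBl mul1mx -scalemxAl mulmxDr mulmx1.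
move: (1%:M) (K *m K) => I Z.
by apply/matrixP => i j; rewrite !mxE; ring.
Qed.

(** Each splitting A = B - C has B^-1 C = 1 - B^-1 A, and the weights a, a, b
add up to 1. *)
Lemma Hab_1B : Hab a b A = 1%:M - Gab a b A *m A.
Proof.
have Lu := (mulmx1_unit leftB_mul_inv).1.
have Ru := (mulmx1_unit rightB_mul_inv).1.
rewrite /Hab /leftC /rightC /diagC !mulVmx_sub // /Gab.
rewrite mulmxDl -!scalemxAl mulmxDl.
have -> : b = 1 - 2 * a by move: hab; lra.
move: (1%:M) (invmx _ *m A) (invmx _ *m A) (invmx _ *m A) => I Z1 Z2 Z3.
by apply/matrixP => i j; rewrite !mxE; ring.
Qed.

(** The endpoint a = 0 is the block Jacobi iteration - K; at a = 1 the stair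
splittings combine into K^2. *)
Lemma Hab_contraction : 0 <= a -> a <= 1 -> contraction A (Hab a b A).
Proof.
move=> a0 a1; rewrite Hab_1B Gab_mulA subKr.
have DKc := scaled_offdiag_contraction Aspd Atri.
rewrite [X in contraction X _]DK; apply: contraction_convex => //.
  exact: contraction_shiftN.
exact: contraction_shift_sqr.
Qed.

(** Since G A = 1 - H, the sum telescopes to 1 - H^m after multiplication by A
on the right. *)
Lemma Minv_congr m : Minv a b m A =
  (invmx A)^T *m (A - A *m Hab a b A ^+ m) *m invmx A.
Proof.
have Au := spd_unitmx Aspd; rewrite trmx_inv Aspd.1.
rewrite mulmxBr mulVmx // mulKmx //.
apply: (can_inj (mulmxK Au)); rewrite mulmxKV // /Minv -mulmxA.
have -> : Gab a b A *m A = 1%:M - Hab a b A by rewrite Hab_1B subKr.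
elim: m => [|m IHm]; first by rewrite big_geq // mul0mx expr0 subrr.
rewrite big_nat_recr //= mulmxDl IHm mulmxBr mulmx1 exprSr -mulmxE.
by rewrite addrA subrK.
Qed.

End Iteration.
End Blocks.

Unset Implicit Arguments.

Theorem mainTheorem1 (R : realType) (N n : nat) (hN : (1 <= N)%N)
    (hn : (1 <= n)%N) (A : blockmx R N n) (A_spd : spd A)
    (A_tri : block_tridiagonal A) (a b : R) (hab : 2 * a + b = 1)
    (ha : 0 <= a) (hb : -1 <= b) :
  [/\ spd (Gab a b A),
      convergent_splitting A (Bab a b A) (Cab a b A)
        /\ spectral_radius (Hab a b A) < 1
    & forall m : nat, (1 <= m)%N -> spd (Minv a b m A)].
Proof.
have a1 : a <= 1 by lra.
have Hc := Hab_contraction A_spd A_tri hab ha a1.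
have Mspd m : (1 <= m)%N -> spd (Minv a b m A).
  move=> m1; rewrite Minv_congr //; apply: spd_congr; last exact: spd_sub_exp.
  by rewrite unitmx_inv spd_unitmx.
have Gspd : spd (Gab a b A).
  by have := Mspd 1%N isT; rewrite /Minv big_nat1 expr0 mul1mx.
have Gu := spd_unitmx Gspd.
have rho : spectral_radius (Hab a b A) < 1 := contraction_spectral_radius Hc.
split; [exact: Gspd | split; last exact: rho | exact: Mspd]; split.
- rewrite /splitting /Bab /Cab Hab_1B // mulmxBr mulmx1 mulKmx //.
  by rewrite subKr.
- by rewrite unitmx_inv.
- by rewrite /Bab /Cab invmxK mulKVmx.
Qed.
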